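(* Let $\Sigma$ be a system as in the context and let $R\in\mathbb R^{r\times n}$ with $\mathrm{rank}(R)=n_{\mathrm{bis}}$ be such that $A\ker(R)\subseteq\ker(R)\subseteq\ker(C)$ and $\ker(R)\cap\mathrm{im}(\mathcal{R}each(A,G))=\{0\}$. Let $\mathbb T=[\mathbb T^1\ \ \mathbb T^2]\in\mathbb R^{n\times n}$ be any invertible matrix with $\mathbb T^1\in\mathbb R^{n\times n_{\mathrm{bis}}}$, $\mathrm{im}(\mathbb T^2)=\ker(R)$ and $\mathrm{im}(\mathcal{R}each(A,G))\subseteq\mathrm{im}(\mathbb T^1)$. Let $A^{11}$ be the upper-left $n_{\mathrm{bis}}\times n_{\mathrm{bis}}$ block of $\mathbb T^{-1}A\mathbb T$, $B^1$ and $G^1$ the first $n_{\mathrm{bis}}$ rows of $\mathbb T^{-1}B$ and $\mathbb T^{-1}G$, and $C^1=C\mathbb T^1$. Let $\Sigma_{/\mathcal R_{\mathrm{bis}}}$ be the system $x(t+1)=A^{11}x(t)+B^1u(t)+G^1w(t)$, $y(t)=C^1x(t)+\nu(t)$, $x\in\mathbb R^{n_{\mathrm{bis}}}$, with $w(t)\sim\mathcal N(\mu,I_l)$ and $\nu(t)\sim\mathcal N(0,\Psi)$ as for $\Sigma$. Then $\Sigma_{/\mathcal R_{\mathrm{bis}}}\cong_{\mathrm{bis}}\Sigma$.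
   Context: $\Sigma$: $x(t+1)=Ax(t)+Bu(t)+Gw(t)$, $y(t)=Cx(t)+\nu(t)$, $t\in\mathbb N$, $x\in\mathbb R^n$, $u\in\mathbb R^m$, $w\in\mathbb R^l$, $y,\nu\in\mathbb R^p$, where $(w(t))_t$ is i.i.d. $\mathcal N(\mu,I_l)$, $(\nu(t))_t$ is i.i.d. $\mathcal N(0,\Psi)$, mutually independent. $\mathcal{R}each(A,G)=[G\ AG\ \cdots\ A^{n-1}G]$. For any such system $\Sigma_i$ (matrices $A_i,B_i,C_i,G_i$, state dimension $n_i$, noises $w_i,\nu_i$) with deterministic initial state $x_i^0$ and deterministic input $\mathbf u:\mathbb N\to\mathbb R^m$, $\mathbf x_i|_{x_i^0,\mathbf u}(t)=A_i^tx_i^0+\sum_{\tau=0}^{t-1}A_i^{t-1-\tau}(B_iu(\tau)+G_iw_i(\tau))$, $\mathbf y_i|_{x_i^0,\mathbf u}(t)=C_i\mathbf x_i|_{x_i^0,\mathbf u}(t)+\nu_i(t)$; $\mathbf P(\cdot\mid x_i^0)$ is probability for the process started at $x_i^0$. Processes are stochastically equivalent ($\sim$) if all finite-dimensional joint distributions coincide. $\mathrm{supp}(v)=\{z:\mathbf P(v\in B_\rho(z))>0\ \forall\rho>0\}$. For a relation $\mathcal R$: $\mathcal R(X_1)=\{x_2:\exists x_1\in X_1,(x_1,x_2)\in\mathcal R\}$, $\mathcal R^{-1}(X_2)=\{x_1:\exists x_2\in X_2,(x_1,x_2)\in\mathcal R\}$; total means $\mathcal R(\mathbb R^{n_1})=\mathbb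 R^{n_2}$ and $\mathcal R^{-1}(\mathbb R^{n_2})=\mathbb R^{n_1}$. A subspace $\mathcal R\subseteq\mathbb R^{n_1}\times\mathbb R^{n_2}$ is a stochastic bisimulation relation between $\Sigma_1,\Sigma_2$ if for every $(x_1^0,x_2^0)\in\mathcal R$, every input $\mathbf u$ and every $t\in\mathbb N$: (i) for every measurable $X_1\subseteq\mathcal R^{-1}(\mathbb R^{n_2})$, $\mathbf P(\mathbf x_1|_{x_1^0,\mathbf u}(t)\in X_1\mid x_1^0)=\mathbf P(\mathbf x_2|_{x_2^0,\mathbf u}(t)\in\mathcal R(X_1\cap\mathrm{supp}(\mathbf x_1|_{x_1^0,\mathbf u}(t)))\mid x_2^0)$; (ii) for every measurable $X_2\subseteq\mathcal R(\mathbb R^{n_1})$, $\mathbf P(\mathbf x_2|_{x_2^0,\mathbf u}(t)\in X_2\mid x_2^0)=\mathbf P(\mathbf x_1|_{x_1^0,\mathbf u}(t)\in\mathcal R^{-1}(X_2\cap\mathrm{supp}(\mathbf x_2|_{x_2^0,\mathbf u}(t)))\mid x_1^0)$; (iii) $\mathbf y_1|_{x_1^0,\mathbf u}\sim\mathbf y_2|_{x_2^0,\mathbf u}$. $\Sigma_1\cong_{\mathrm{bis}}\Sigma_2$ if a total stochastic bisimulation relation between them exists. *)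

(* Defs.v *)
From HB Require Import structures.
From mathcomp Require Import all_boot all_order all_algebra.
From mathcomp Require Import all_classical all_reals all_analysis.
Set Implicit Arguments. Unset Strict Implicit. Unset Printing Implicit Defensive.
Import Order.TTheory GRing.Theory Num.Theory.
Import numFieldNormedType.Exports.
Local Open Scope classical_set_scope.
Local Open Scope ring_scope.

Section StochasticLinearSystems.
Variable R : realType.

(** Borel sets of R^(m x k) (matrices carry the product/sup-norm topology). *)
Definition mx_borel (m k : nat) (B : set 'M[R]_(m, k)) : Prop := <<s open >> B.

Definition vdot (k : nat) (a b : 'cV[R]_k) : R := (a^T *m b) ord0 ord0.

(** [X ~ N(mean, S)]: X is a Borel random vector whose characteristic function
    is t |-> exp(i t'mean - t'S t / 2) (real and imaginary parts separately). *)
Definition gaussian_law d (Om : measurableType d) (P : probability Om R)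
  (k : nat) (X : Om -> 'cV[R]_k) (mean : 'cV[R]_k) (S : 'M[R]_k) : Prop :=
  (forall B, mx_borel B -> measurable (X @^-1` B)) /\
  forall th : 'cV[R]_k,
    (\int[P]_w (cos (vdot th (X w)))%:E
       = (expR (- vdot th (S *m th) / 2) * cos (vdot th mean))%:E)%E /\
    (\int[P]_w (sin (vdot th (X w)))%:E
       = (expR (- vdot th (S *m th) / 2) * sin (vdot th mean))%:E)%E.

(** Standing noise assumptions: (w(t))_t i.i.d. N(mu, I_l), (nu(t))_t i.i.d.
    N(0, Psi), the whole family {w(t), nu(t) : t} mutually independent
    (product rule on every finite subfamily; unused members get the full set). *)
Definition noise_hyp d (Om : measurableType d) (P : probability Om R)
  (l p : nat) (w : nat -> Om -> 'cV[R]_l) (nu : nat -> Om -> 'cV[R]_p)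
  (mu : 'cV[R]_l) (Psi : 'M[R]_p) : Prop :=
  (forall t, gaussian_law P (w t) mu 1%:M) /\
  (forall t, gaussian_law P (nu t) 0 Psi) /\
  (forall (N : nat) (Aw : nat -> set 'cV[R]_l) (Bn : nat -> set 'cV[R]_p),
     (forall t, mx_borel (Aw t)) -> (forall t, mx_borel (Bn t)) ->
     P (\bigcap_(t in `I_N) (w t @^-1` Aw t `&` nu t @^-1` Bn t))
     = (\prod_(t < N) (P (w t @^-1` Aw t) * P (nu t @^-1` Bn t)))%E).

Definition traj d (Om : measurableType d) (n m l : nat)
  (A : 'M[R]_n) (B : 'M[R]_(n, m)) (G : 'M[R]_(n, l))
  (w : nat -> Om -> 'cV[R]_l) (x0 : 'cV[R]_n) (u : nat -> 'cV[R]_m)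
  (t : nat) (om : Om) : 'cV[R]_n :=
  A ^+ t *m x0 + \sum_(tau < t) A ^+ (t - tau).-1 *m (B *m u tau + G *m w tau om).

Definition outp d (Om : measurableType d) (n m l p : nat)
  (A : 'M[R]_n) (B : 'M[R]_(n, m)) (G : 'M[R]_(n, l)) (C : 'M[R]_(p, n))
  (w : nat -> Om -> 'cV[R]_l) (nu : nat -> Om -> 'cV[R]_p)
  (x0 : 'cV[R]_n) (u : nat -> 'cV[R]_m) (t : nat) (om : Om) : 'cV[R]_p :=
  C *m traj A B G w x0 u t om + nu t om.

Definition supp d (Om : measurableType d) (P : probability Om R) (n : nat)
  (X : Om -> 'cV[R]_n) : set 'cV[R]_n :=
  [set z | forall rho : R, 0 < rho -> (0 < P (X @^-1` ball z rho))%E].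

(** Stochastic equivalence: all finite-dimensional joint distributions agree
    (the vector (Y(t_1),...,Y(t_k)) is arranged as the columns of a p x k matrix). *)
Definition stoch_equiv d1 (Om1 : measurableType d1) (P1 : probability Om1 R)
  d2 (Om2 : measurableType d2) (P2 : probability Om2 R) (p : nat)
  (Y1 : nat -> Om1 -> 'cV[R]_p) (Y2 : nat -> Om2 -> 'cV[R]_p) : Prop :=
  forall (k : nat) (ts : 'I_k -> nat) (Bs : set 'M[R]_(p, k)), mx_borel Bs ->
    P1 ((fun om => \matrix_(i < p, j < k) Y1 (ts j) om i ord0) @^-1` Bs)
    = P2 ((fun om => \matrix_(i < p, j < k) Y2 (ts j) om i ord0) @^-1` Bs).

Definition lin_rel (n1 n2 : nat) (S : set ('cV[R]_n1 * 'cV[R]_n2)) : Prop :=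
  S (0, 0) /\
  forall (a : R) (x y : 'cV[R]_n1 * 'cV[R]_n2),
    S x -> S y -> S (a *: x.1 + y.1, a *: x.2 + y.2).

Definition rel_img (n1 n2 : nat) (S : set ('cV[R]_n1 * 'cV[R]_n2))
  (X1 : set 'cV[R]_n1) : set 'cV[R]_n2 :=
  [set x2 | exists2 x1, X1 x1 & S (x1, x2)].

Definition rel_pre (n1 n2 : nat) (S : set ('cV[R]_n1 * 'cV[R]_n2))
  (X2 : set 'cV[R]_n2) : set 'cV[R]_n1 :=
  [set x1 | exists2 x2, X2 x2 & S (x1, x2)].

Definition total_rel (n1 n2 : nat) (S : set ('cV[R]_n1 * 'cV[R]_n2)) : Prop :=
  rel_img S setT = setT /\ rel_pre S setT = setT.

Definition stoch_bisim (n1 n2 m l p : nat)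
  (A1 : 'M[R]_n1) (B1 : 'M[R]_(n1, m)) (G1 : 'M[R]_(n1, l)) (C1 : 'M[R]_(p, n1))
  d1 (Om1 : measurableType d1) (P1 : probability Om1 R)
  (w1 : nat -> Om1 -> 'cV[R]_l) (nu1 : nat -> Om1 -> 'cV[R]_p)
  (A2 : 'M[R]_n2) (B2 : 'M[R]_(n2, m)) (G2 : 'M[R]_(n2, l)) (C2 : 'M[R]_(p, n2))
  d2 (Om2 : measurableType d2) (P2 : probability Om2 R)
  (w2 : nat -> Om2 -> 'cV[R]_l) (nu2 : nat -> Om2 -> 'cV[R]_p)
  (S : set ('cV[R]_n1 * 'cV[R]_n2)) : Prop :=
  lin_rel S /\
  forall (x10 : 'cV[R]_n1) (x20 : 'cV[R]_n2), S (x10, x20) ->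
  forall (u : nat -> 'cV[R]_m) (t : nat),
    (forall X1 : set 'cV[R]_n1, mx_borel X1 -> X1 `<=` rel_pre S setT ->
       P1 (traj A1 B1 G1 w1 x10 u t @^-1` X1)
       = P2 (traj A2 B2 G2 w2 x20 u t @^-1`
               rel_img S (X1 `&` supp P1 (traj A1 B1 G1 w1 x10 u t)))) /\
    (forall X2 : set 'cV[R]_n2, mx_borel X2 -> X2 `<=` rel_img S setT ->
       P2 (traj A2 B2 G2 w2 x20 u t @^-1` X2)
       = P1 (traj A1 B1 G1 w1 x10 u t @^-1`
               rel_pre S (X2 `&` supp P2 (traj A2 B2 G2 w2 x20 u t)))) /\
    stoch_equiv P1 P2 (outp A1 B1 G1 C1 w1 nu1 x10 u)
                      (outp A2 B2 G2 C2 w2 nu2 x20 u).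

Definition bisimilar (n1 n2 m l p : nat)
  (A1 : 'M[R]_n1) (B1 : 'M[R]_(n1, m)) (G1 : 'M[R]_(n1, l)) (C1 : 'M[R]_(p, n1))
  d1 (Om1 : measurableType d1) (P1 : probability Om1 R)
  (w1 : nat -> Om1 -> 'cV[R]_l) (nu1 : nat -> Om1 -> 'cV[R]_p)
  (A2 : 'M[R]_n2) (B2 : 'M[R]_(n2, m)) (G2 : 'M[R]_(n2, l)) (C2 : 'M[R]_(p, n2))
  d2 (Om2 : measurableType d2) (P2 : probability Om2 R)
  (w2 : nat -> Om2 -> 'cV[R]_l) (nu2 : nat -> Om2 -> 'cV[R]_p) : Prop :=
  exists S : set ('cV[R]_n1 * 'cV[R]_n2),
    stoch_bisim A1 B1 G1 C1 P1 w1 nu1 A2 B2 G2 C2 P2 w2 nu2 S /\ total_rel S.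

(** im(Reach(A,G)) = im [G AG ... A^{n-1}G]. *)
Definition reach_im (n l : nat) (A : 'M[R]_n) (G : 'M[R]_(n, l)) : set 'cV[R]_n :=
  [set x | exists v : 'I_n -> 'cV[R]_l, x = \sum_(k < n) A ^+ k *m G *m v k].

Definition mxker (r n : nat) (M : 'M[R]_(r, n)) : set 'cV[R]_n :=
  [set x | M *m x = 0].
Definition mximg (n k : nat) (M : 'M[R]_(n, k)) : set 'cV[R]_n :=
  [set x | exists v : 'cV[R]_k, x = M *m v].

End StochasticLinearSystems.

(* Main.v *)
(** The relation is the graph x1 = Q x2 of Q, the first n_bis rows of T^-1.
    Since ker R = im T^2 is A-invariant and contained in ker C, Q intertwines A
    with A^11 and C = C^1 Q; hence Q maps trajectories of Sigma to trajectories of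
    the quotient driven by the same noise, and leaves the outputs unchanged.
    It remains to compare two noises living on different probability spaces:
    they have the same joint law because a characteristic function determines the
    law and by independence.  Two points make (i) and (ii) work: supports are
    closed and have full measure, and by Cayley-Hamilton the state of Sigma stays
    in a translate of im(Reach) by a deterministic vector, so its support does too;
    there Q is inverted by an affine map, which makes images under Q of Borel
    subsets of the support Borel.

    Uniqueness of characteristic functions is proved without Fourier inversion.
    The functions F with E[F(X_1) e^(i<th, X_1>)] = E[F(X_2) e^(i<th, X_2>)] for
    all th contain 1 and are stable under multiplication by trigonometric
    polynomials and under bounded pointwise limits.  Bounded polynomials that
    converge to the indicator of y >= 0 on [-1, 1], applied to
    y = sin ((x_j - a) / n) with n -> oo, put the indicators of half-spaces, then
    those of orthants, in this class; orthants are a pi-system generating the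
    Borel sets. *)
Require Import Defs.
From HB Require Import structures.
From mathcomp Require Import all_boot all_order all_algebra.
From mathcomp Require Import all_classical all_reals all_analysis.
From mathcomp Require Import measurable_realfun ring lra.
Import Order.TTheory GRing.Theory Num.Theory.
Import numFieldNormedType.Exports.
Local Open Scope classical_set_scope.
Local Open Scope ring_scope.

(** * Borel sets of matrices *)

Section MatrixBorel.
Context {R : realType}.

Definition ratball {m k : nat} (c : 'M[rat]_(m, k) * nat) : set 'M[R]_(m, k) :=
  ball (map_mx ratr c.1 : 'M[R]_(m, k)) (c.2.+1%:R^-1).

Lemma open_ratball {m k} (c : 'M[rat]_(m, k) * nat) : open (ratball c).
Proof. exact: ball_open. Qed.

Lemma ratball_basis {m k} (U : set 'M[R]_(m, k)) x : nbhs x U ->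
  exists2 c, ratball c x & ratball c `<=` U.
Proof.
move=> /nbhs_ballP[e /= e0 xeU].
have [n ne] : exists n, n.+1%:R^-1 < e / 2.
  have /ltr_add_invr[n nP] : (0 : R) < e / 2 by rewrite divr_gt0.
  by exists n; rewrite add0r in nP.
have n0 : 0 < n.+1%:R^-1 :> R by rewrite invr_gt0.
have H i j : exists q : rat, ball (x i j) n.+1%:R^-1 (ratr q).
  have [|q] := @rat_in_itvoo R (x i j - n.+1%:R^-1) (x i j + n.+1%:R^-1).
    by rewrite ltrD2l gtrN.
  rewrite in_itv /= => /andP[q1 q2]; exists q.
  by rewrite /ball /= ltr_distlC q1 q2.
pose q := \matrix_(i, j) projT1 (cid (H i j)).
have xq : ball x n.+1%:R^-1 (map_mx ratr q).
  split => // i j; rewrite !mxE; exact: projT2 (cid (H i j)).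
exists (q, n); first exact: ball_sym.
move=> y qy; apply: xeU; rewrite (splitr e).
apply: ball_triangle; [exact: le_ball (ltW ne) _ xq|exact: le_ball (ltW ne) _ qy].
Qed.

(** Open sets are countable unions of rational balls, and a sup-norm ball is a finite intersection
    of conditions on single entries. *)
Lemma mx_measurable_fun d (T : measurableType d) m k (X : T -> 'M[R]_(m, k)) :
  (forall i j, measurable_fun setT (fun t => X t i j)) ->
  forall B, mx_borel B -> measurable (X @^-1` B).
Proof.
move=> mX B.
suff mXo : measurable_fun setT (X : T -> g_sigma_algebraType (@open 'M[R]_(m, k))).
  by move=> mB; rewrite -[_ @^-1` _]setTI; apply: mXo.
have := @measurability _ _ T (g_sigma_algebraType (@open 'M[R]_(m, k))) setT X open.
apply => // _ [U oU <-]; rewrite setTI.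
(* The union runs over all rational balls, with the empty set in place of those that leave [U], so
   that the index type stays countable. *)
have -> : X @^-1` U =
    \bigcup_c (if `[< ratball c `<=` U >] then X @^-1` (ratball c) else set0).
  apply/seteqP; split => [t Ut | t [c _]]; last first.
    by case: asboolP => // cU /cU.
  have [c cx cU] := @ratball_basis _ _ U (X t) (open_nbhs_nbhs (conj oU Ut)).
  by exists c => //; case: asboolP.
apply: countable_bigcupT_measurable => [|c]; first exact: countableP.
case: ifP => // _.
have -> : X @^-1` ratball c = \bigcap_i \bigcap_j
    ((fun t => X t i j) @^-1` ball (ratr (c.1 i j) : R) c.2.+1%:R^-1).
  apply/seteqP; split => [t [_ ct] i _ j _ | t ct].
    by move: (ct i j); rewrite mxE.
  by split => [|i j]; [rewrite invr_gt0|rewrite mxE; exact: ct].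
apply: fin_bigcap_measurable => // i _.
apply: fin_bigcap_measurable => // j _.
by rewrite -[_ @^-1` _]setTI; apply: mX => //; exact: measurable_ball.
Qed.

Lemma measurable_entry m k (i : 'I_m) (j : 'I_k) :
  measurable_fun setT
    ((fun M => M i j) : g_sigma_algebraType (@open 'M[R]_(m, k)) -> R).
Proof.
apply: (measurability _ (RGenOpens.measurableE R)) => _ [_ [a [b ->]] <-].
rewrite setTI; apply: sub_sigma_algebra.
have /continuousP := @coord_continuous R m k i j.
by apply; exact: interval_open.
Qed.

Lemma measurable_fun_entry d (T : measurableType d) m k (X : T -> 'M[R]_(m, k)) :
  (forall B, mx_borel B -> measurable (X @^-1` B)) ->
  forall i j, measurable_fun setT (fun t => X t i j).
Proof.
move=> mX i j.
apply: (@measurableT_comp _ _ _ _ (g_sigma_algebraType (@open 'M[R]_(m, k))) _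
  (fun M => M i j) _ X).
  exact: measurable_entry.
by move=> _ B mB; rewrite setTI; exact: mX.
Qed.

End MatrixBorel.

(** * Characteristic functions determine laws *)

Section StepPolynomials.
Context {R : realType}.
Implicit Types u y z : R.

Lemma bernoulli_sub u c : 0 <= u <= 1 -> 1 - c%:R * u <= (1 - u) ^+ c.
Proof.
move=> /andP[u0 u1]; elim: c => [|c IH]; first by rewrite mul0r subr0 expr0.
rewrite exprS; apply: le_trans (_ : (1 - u) * (1 - c%:R * u) <= _); last first.
  by apply: ler_wpM2l => //; rewrite subr_ge0.
have : 0 <= c%:R * u * u by rewrite !mulr_ge0.
rewrite -natr1; lra.
Qed.

Lemma bernoulli_add u c : 0 <= u -> 1 + c%:R * u <= (1 + u) ^+ c.
Proof.
move=> u0; elim: c => [|c IH]; first by rewrite mul0r addr0 expr0.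
rewrite exprS; apply: le_trans (_ : (1 + u) * (1 + c%:R * u) <= _); last first.
  by apply: ler_wpM2l => //; rewrite addr_ge0.
have : 0 <= c%:R * u * u by rewrite !mulr_ge0.
rewrite -natr1; lra.
Qed.

(* With z = (1 - y) / 2 and c = 2 ^ (n^2 - n), the exponents are chosen so that
   c z ^ (n^2) tends to 0 for z <= 1/2 (included) and to infinity for z > 1/2. *)
Definition step_poly (n : nat) (y : R) : R :=
  (1 - ((1 - y) / 2) ^+ (n * n)) ^+ (2 ^ (n * n - n)).

Lemma step_poly_itv n y : `|y| <= 1 -> 0 <= step_poly n y <= 1.
Proof.
move=> /[!ler_norml]/andP[y1 y2].
have z0 : 0 <= (1 - y) / 2 by lra.
have z1 : (1 - y) / 2 <= 1 by lra.
have u0 := exprn_ge0 (n * n) z0.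
have u1 := exprn_ile1 (n * n) z0 z1.
by rewrite /step_poly exprn_ge0 ?exprn_ile1 ?subr_ge0// gerBl.
Qed.

(** Bernoulli: (1 - u)^c >= 1 - c u. Here u = z^(n^2) with z <= 1/2, so c u <= 2^(n^2 - n) 2^(-n^2)
    = 2^(-n). *)
Lemma step_poly_ge y n : 0 <= y <= 1 -> 1 - 2^-1 ^+ n <= step_poly n y.
Proof.
move=> /andP[y0 y1].
have z0 : 0 <= (1 - y) / 2 by lra.
have z1 : (1 - y) / 2 <= 2^-1 by lra.
apply: le_trans (bernoulli_sub _ _ _); last first.
  rewrite exprn_ge0//= exprn_ile1//; lra.
rewrite lerD2l lerN2 natrX.
apply: (@le_trans _ _ (2 ^+ (n * n - n) * 2^-1 ^+ (n * n))).
  by apply: ler_wpM2l; [rewrite exprn_ge0|apply: lerXn2r => //; rewrite nnegrE].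
have nn : (n <= n * n)%N by case: n => // n; rewrite leq_pmulr.
rewrite -{2}(subnK nn) exprD mulrA -exprMn divff ?expr1n ?mul1r//.
Qed.

(** Since (1 - u)^c (1 + u)^c <= 1, Bernoulli bounds the value by 1 / (c u). Moreover c u = ((1 -
    y)^n / 2)^n, which is at least 2^n once (1 - y)^n >= 4. *)
Lemma step_poly_le y n : -1 <= y <= 1 -> 4 <= (1 - y) ^+ n ->
  step_poly n y <= 2^-1 ^+ n.
Proof.
move=> /andP[y0 y1] yn; set z := (1 - y) / 2.
have z0 : 0 <= z by rewrite /z; lra.
have z1 : z <= 1 by rewrite /z; lra.
set u := z ^+ (n * n); have u0 : 0 <= u by rewrite exprn_ge0.
have u1 : u <= 1 by rewrite exprn_ile1.
set c := (2 ^ (n * n - n))%N.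
have cu : 2 ^+ n <= c%:R * u.
  have nn : (n <= n * n)%N by case: (n) => // k; rewrite leq_pmulr.
  have -> : c%:R * u = ((1 - y) ^+ n / 2) ^+ n.
    have h k : 2 ^+ k * 2^-1 ^+ k = 1 :> R by rewrite -exprMn divff ?expr1n.
    rewrite /c /u natrX /z !exprMn -exprM.
    have -> : 2 ^+ (n * n - n) = 2 ^+ (n * n) * 2^-1 ^+ n :> R.
      by rewrite -{2}(subnK nn) exprD -mulrA h mulr1.
    move: (2 ^+ (n * n)) (2^-1 ^+ (n * n)) (2^-1 ^+ n) ((1 - y) ^+ (n * n))
      (h (n * n)%N) => a b e f ab.
    by rewrite -[RHS]mul1r -ab; ring.
  by apply: lerXn2r; rewrite ?nnegrE//; lra.
have pu : step_poly n y * (1 + u) ^+ c <= 1.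
  rewrite /step_poly -/z -/u -/c -exprMn exprn_ile1//.
    by rewrite mulr_ge0 ?subr_ge0 ?addr_ge0.
  by have : 0 <= u * u by [rewrite mulr_ge0]; lra.
have /andP[p0 _] : 0 <= step_poly n y <= 1.
  by apply: step_poly_itv; rewrite ler_norml y0.
have : step_poly n y * 2 ^+ n <= 1.
  apply: le_trans pu; apply: ler_wpM2l => //.
  by apply: le_trans (bernoulli_add _ _ u0); apply: le_trans cu _; rewrite lerDr.
by rewrite exprVn -ler_pdivlMr ?exprn_gt0// div1r.
Qed.

Lemma step_poly_cvg y : `|y| <= 1 -> step_poly n y @[n --> \oo] --> ((0 <= y)%R%:R : R).
Proof.
move=> y1.
have near_le : \forall n \near \oo, `|step_poly n y - (0 <= y)%R%:R| <= 2^-1 ^+ n.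
  have /[!ler_norml]/andP[y2 y3] := y1.
  case: (leP 0 y) => y0.
    near=> n; have /andP[_ p1] := @step_poly_itv n y y1.
    rewrite ler0_norm ?subr_le0// opprB lerBlDr addrC -lerBlDr.
    by apply: step_poly_ge; rewrite y0.
  (* For y < 0, Bernoulli gives (1 - y)^n >= 1 + n (-y), so the hypothesis of [step_poly_le] holds
     from this [N] on. *)
  have [N Ny] : exists N, 4 <= 1 + N%:R * - y.
    exists (Num.truncn (3 / - y)).+1.
    have := truncnS_gt (3 / - y); rewrite ltr_pdivrMr ?oppr_gt0//; lra.
  exists N => // n /= Nn; have /andP[p0 _] := @step_poly_itv n y y1.
  rewrite subr0 ger0_norm//; apply: step_poly_le; rewrite ?y2//.
  apply: le_trans Ny _; apply: le_trans (_ : 1 + n%:R * - y <= _).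
    by rewrite lerD2l ler_wpM2r ?ler_nat// oppr_ge0 ltW.
  by apply: bernoulli_add; rewrite oppr_ge0 ltW.
apply/cvgrPdist_le => e e0.
have /cvgrPdist_le/(_ _ e0) : (2^-1 : R) ^+ n @[n --> \oo] --> 0.
  apply: cvg_expr; rewrite ger0_norm//; lra.
move: near_le; apply: filterS2 => n ne; rewrite sub0r normrN ger0_norm ?exprn_ge0// => ne'.
by rewrite distrC; exact: le_trans ne'.
Unshelve. all: by end_near. Qed.

(** Once n + 1 > |x| / pi, the argument lies in (-pi, pi), where the sine has the sign of its
    argument: the sequence is eventually constant. Letting n grow removes the periodicity of the
    sine. *)
Lemma sin_step_cvg (x : R) :
  ((0 <= sin (x / n.+1%:R))%R%:R : R) @[n --> \oo] --> ((0 <= x)%R%:R : R).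
Proof.
have pi0 := @pi_gt0 R.
have [N Nx] : exists N, `|x| < N.+1%:R * pi.
  exists (Num.truncn (`|x| / pi)).
  by have := truncnS_gt (`|x| / pi); rewrite ltr_pdivrMr.
apply/(@cvg_near_cst _ _ _ _ _ _).
exists N => // n /= Nn.
have n0 : (0 : R) < n.+1%:R by [].
have : `|x| < pi * n.+1%:R.
  by rewrite mulrC; apply: lt_le_trans Nx _; rewrite ler_pM2r// ler_nat.
rewrite -ltr_pdivrMr// -[X in _ / X](gtr0_norm n0) -normf_div => xpi.
case: (ltgtP x 0) => x0.
- have y0 : x / n.+1%:R < 0 by rewrite pmulr_llt0 ?invr_gt0.
  rewrite leNgt -oppr_gt0 -sinN sin_gt0_pi//; rewrite oppr_gt0 y0/=.
  by rewrite -(ltr0_norm y0).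
- have y0 : 0 < x / n.+1%:R by rewrite divr_gt0.
  by rewrite ltW// sin_gt0_pi// y0 -(gtr0_norm y0).
- by rewrite x0 mul0r sin0 lexx.
Qed.

End StepPolynomials.

(** * Bounded functions with equal means under two laws *)

Section SameMean.
Context {R : realType} {d1 d2 : measure_display}.
Context {Om1 : measurableType d1} {Om2 : measurableType d2}.
Variables (P1 : probability Om1 R) (P2 : probability Om2 R).
Context {V : Type}.
Variables (X1 : Om1 -> V) (X2 : Om2 -> V).
Implicit Types F G : V -> R.

(** Measurability and boundedness are bundled in, so that linear combinations and dominated limits
    raise no integrability conditions. *)
Definition same_mean F : Prop :=
  [/\ measurable_fun setT (F \o X1), measurable_fun setT (F \o X2),
      exists M : R, forall x, `|F x| <= M &
      (\int[P1]_w (F (X1 w))%:E = \int[P2]_w (F (X2 w))%:E)%E].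

Lemma bounded_integrable d (Om : measurableType d) (P : probability Om R)
    (f : Om -> R) (M : R) :
  measurable_fun setT f -> (forall x, `|f x| <= M) -> P.-integrable setT (EFin \o f).
Proof.
move=> mf fM; apply: measurable_bounded_integrable => //.
  by rewrite (le_lt_trans (probability_le1 _ _)) ?ltry.
exists M; split; first exact: num_real.
by move=> y My x _; apply: le_trans (fM x) _; exact: ltW.
Qed.

Lemma same_mean_lin a F G :
  same_mean F -> same_mean G -> same_mean (fun x => a * F x + G x).
Proof.
move=> [mF1 mF2 [M FM] eF] [mG1 mG2 [N GN] eG]; split.
- by apply: measurable_funD => //; apply: measurable_funM.
- by apply: measurable_funD => //; apply: measurable_funM.
- exists (`|a| * M + N) => x; rewrite (le_trans (ler_normD _ _))// normrM.
  by rewrite lerD// ler_wpM2l.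
have H d (Om : measurableType d) (P : probability Om R) (X : Om -> V) :
    measurable_fun setT (F \o X) -> measurable_fun setT (G \o X) ->
    (\int[P]_w (a * F (X w) + G (X w))%:E =
      a%:E * \int[P]_w (F (X w))%:E + \int[P]_w (G (X w))%:E)%E.
  move=> mF mG.
  have iF : P.-integrable setT (EFin \o (F \o X)).
    by apply: (@bounded_integrable _ _ _ _ M) => // x; exact: FM.
  have iG : P.-integrable setT (EFin \o (G \o X)).
    by apply: (@bounded_integrable _ _ _ _ N) => // x; exact: GN.
  rewrite -integralZl//= -integralD//=; exact: integrableZl.
by rewrite H// H// eF eG.
Qed.

Lemma same_mean_lim (F_ : nat -> V -> R) F (M : R) :
  (forall n, same_mean (F_ n)) -> (forall n x, `|F_ n x| <= M) ->
  (forall x, F_ n x @[n --> \oo] --> F x) -> same_mean F.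
Proof.
move=> sF FM cF.
have mF1 : measurable_fun setT (F \o X1).
  apply: (measurable_fun_cvg (h := fun n => F_ n \o X1)) => [n|x _].
    by have [] := sF n.
  exact: cF.
have mF2 : measurable_fun setT (F \o X2).
  apply: (measurable_fun_cvg (h := fun n => F_ n \o X2)) => [n|x _].
    by have [] := sF n.
  exact: cF.
split => //.
  exists M => x.
  by apply: (cvgr_to_le (cvg_norm (cF x))); exact: nearW.
have H d (Om : measurableType d) (P : probability Om R) (X : Om -> V) :
    (forall n, measurable_fun setT (F_ n \o X)) -> measurable_fun setT (F \o X) ->
    ((\int[P]_w (F_ n (X w))%:E)%E @[n --> \oo] --> (\int[P]_w (F (X w))%:E)%E).
  move=> mFn mF.
  have [] // := @dominated_convergence _ Om R P setT measurableT
    (fun n w => (F_ n (X w))%:E) (fun w => (F (X w))%:E) (cst M%:E).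
  - by move=> n; exact/measurable_EFinP/mFn.
  - exact/measurable_EFinP/mF.
  - by apply: aeW => w _; apply: cvg_EFin; [exact: nearW|exact: cF].
  - exact: (@bounded_integrable _ _ _ (cst M) `|M|).
  - by apply: aeW => w n _; rewrite lee_fin.
have H1 := H _ _ P1 X1 (fun n => let: And4 m _ _ _ := sF n in m) mF1.
have H2 := H _ _ P2 X2 (fun n => let: And4 _ m _ _ := sF n in m) mF2.
have E : (fun n => \int[P1]_w (F_ n (X1 w))%:E)%E = (fun n => \int[P2]_w (F_ n (X2 w))%:E)%E.
  by apply/funext => n; have [] := sF n.
by rewrite E in H1; exact: (cvg_unique _ H1 H2).
Qed.

End SameMean.

(** * From trigonometric functions to indicators of orthants *)

Section CharacteristicFunction.
Context {R : realType} {d1 d2 : measure_display}.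
Context {Om1 : measurableType d1} {Om2 : measurableType d2}.
Variables (P1 : probability Om1 R) (P2 : probability Om2 R).
Variable k : nat.
Variables (X1 : Om1 -> 'cV[R]_k) (X2 : Om2 -> 'cV[R]_k).
Hypothesis mX1 : forall B, mx_borel B -> measurable (X1 @^-1` B).
Hypothesis mX2 : forall B, mx_borel B -> measurable (X2 @^-1` B).
Hypothesis eq_cos : forall th : 'cV[R]_k,
  (\int[P1]_w (cos (vdot th (X1 w)))%:E = \int[P2]_w (cos (vdot th (X2 w)))%:E)%E.
Hypothesis eq_sin : forall th : 'cV[R]_k,
  (\int[P1]_w (sin (vdot th (X1 w)))%:E = \int[P2]_w (sin (vdot th (X2 w)))%:E)%E.
Implicit Types (F g h : 'cV[R]_k -> R) (th a : 'cV[R]_k).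

Local Notation same := (same_mean P1 P2 X1 X2).

(** Real and imaginary parts of E[F(X) e^(i<th, X>)]. Quantifying over all [th] makes the class
    stable under multiplication by trigonometric functions, which only shifts [th]. *)
Definition same_charfun F : Prop := forall th,
  same (fun x => cos (vdot th x) * F x) /\ same (fun x => sin (vdot th x) * F x).

(** Acting on the class, rather than belonging to it, makes closure under products immediate. *)
Definition multiplier g : Prop :=
  forall F, same_charfun F -> same_charfun (fun x => g x * F x).

Lemma vdotD th a x : vdot (th + a) x = vdot th x + vdot a x.
Proof. by rewrite /vdot linearD mulmxDl mxE. Qed.

Lemma vdotB th a x : vdot (th - a) x = vdot th x - vdot a x.
Proof. by rewrite /vdot linearB mulmxBl !mxE. Qed.

Lemma vdot_delta c (j : 'I_k) (x : 'cV[R]_k) :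
  vdot (c *: delta_mx j ord0) x = c * x j ord0.
Proof.
by rewrite /vdot linearZ /= trmx_delta -scalemxAl -rowE !mxE.
Qed.

Lemma measurable_vdot d (Om : measurableType d) (X : Om -> 'cV[R]_k) th :
  (forall B, mx_borel B -> measurable (X @^-1` B)) ->
  measurable_fun setT (fun w => vdot th (X w)).
Proof.
move=> mX; under eq_fun do rewrite /vdot mxE.
apply: measurable_sum => i; apply: measurable_funM => //.
exact: measurable_fun_entry.
Qed.

Lemma same_charfun1 : same_charfun (cst 1).
Proof.
move=> th; split; split.
1,2: under eq_fun do rewrite /= mulr1.
1,2: by apply: (measurableT_comp (continuous_measurable_fun (@continuous_cos R)));
  exact: measurable_vdot.
- by exists 1 => x; rewrite mulr1 ler_norml cos_geN1 cos_le1.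
- by under eq_integral do rewrite /= mulr1; under [RHS]eq_integral do rewrite /= mulr1.
1,2: under eq_fun do rewrite /= mulr1.
1,2: by apply: (measurableT_comp (continuous_measurable_fun (@continuous_sin R)));
  exact: measurable_vdot.
- by exists 1 => x; rewrite mulr1 ler_norml sin_geN1 sin_le1.
- by under eq_integral do rewrite /= mulr1; under [RHS]eq_integral do rewrite /= mulr1.
Qed.

Lemma same_charfun_same F : same_charfun F -> same F.
Proof.
move=> /(_ 0)[+ _]; congr same; apply/funext => x.
by rewrite /vdot trmx0 mul0mx mxE cos0 mul1r.
Qed.

Lemma same_charfun_lin c F G : same_charfun F -> same_charfun G ->
  same_charfun (fun x => c * F x + G x).
Proof.
move=> sF sG th; have [F1 F2] := sF th; have [G1 G2] := sG th; split.
- have := same_mean_lin _ _ _ _ c _ _ F1 G1; congr same; by apply/funext => x; ring.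
- have := same_mean_lin _ _ _ _ c _ _ F2 G2; congr same; by apply/funext => x; ring.
Qed.

Lemma same_charfun_lim (F_ : nat -> 'cV[R]_k -> R) F (M : R) :
  (forall n, same_charfun (F_ n)) -> (forall n x, `|F_ n x| <= M) ->
  (forall x, F_ n x @[n --> \oo] --> F x) -> same_charfun F.
Proof.
move=> sF FM cF th; split.
- apply: (@same_mean_lim _ _ _ _ _ _ _ _ _ _ (fun n x => cos (vdot th x) * F_ n x) _ M).
  + by move=> n; case: (sF n th).
  + move=> n x; rewrite normrM -[leRHS]mul1r ler_pM// ler_norml.
    by rewrite cos_geN1 cos_le1.
  + by move=> x; apply: cvgMr; exact: cF.
- apply: (@same_mean_lim _ _ _ _ _ _ _ _ _ _ (fun n x => sin (vdot th x) * F_ n x) _ M).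
  + by move=> n; case: (sF n th).
  + move=> n x; rewrite normrM -[leRHS]mul1r ler_pM// ler_norml.
    by rewrite sin_geN1 sin_le1.
  + by move=> x; apply: cvgMr; exact: cF.
Qed.

Lemma multiplier_cst c : multiplier (cst c).
Proof.
(* [same_charfun_lin] scales only its first function, so c F is written (c - 1) F + F. *)
move=> F sF; have := same_charfun_lin (c - 1) F F sF sF; congr same_charfun.
by apply/funext => x /=; ring.
Qed.

Lemma multiplierD g h : multiplier g -> multiplier h ->
  multiplier (fun x => g x + h x).
Proof.
move=> mg mh F sF; have := same_charfun_lin 1 _ _ (mg F sF) (mh F sF).
by congr same_charfun; by apply/funext => x; ring.
Qed.

Lemma multiplierM g h : multiplier g -> multiplier h ->
  multiplier (fun x => g x * h x).
Proof.
move=> mg mh F sF; have := mg _ (mh F sF).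
by congr same_charfun; by apply/funext => x; ring.
Qed.

Lemma multiplierX g n : multiplier g -> multiplier (fun x => g x ^+ n).
Proof.
move=> mg; elim: n => [|n IH]; first exact: multiplier_cst.
have := multiplierM _ _ mg IH; congr multiplier; apply/funext => x.
by rewrite exprS.
Qed.

Lemma multiplier_lim (g_ : nat -> 'cV[R]_k -> R) g :
  (forall n, multiplier (g_ n)) -> (forall n x, `|g_ n x| <= 1) ->
  (forall x, g_ n x @[n --> \oo] --> g x) -> multiplier g.
Proof.
move=> mg g1 cg F sF.
(* The frequency th = 0 shows that [F] itself is bounded; this bound dominates all the products. *)
have [_ _ [M FM] _] := same_charfun_same _ sF.
apply: (same_charfun_lim (fun n x => g_ n x * F x) _ M).
- by move=> n; exact: mg.
- by move=> n x; rewrite normrM -[leRHS]mul1r ler_pM.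
- by move=> x; apply: cvgMl; exact: cg.
Qed.

Lemma same_ext F G : (forall x, F x = G x) -> same F -> same G.
Proof. by move=> /funext ->. Qed.

(** Product-to-sum formulas: multiplying by cos <a, x> averages the values at th + a and th - a. The
    coefficient 2^-1 - 1, followed by adding the same function, amounts to one half. *)
Lemma multiplier_cos a : multiplier (fun x => cos (vdot a x)).
Proof.
move=> F sF th; have [C1 S1] := sF (th + a); have [C2 S2] := sF (th - a); split.
- refine (same_ext _ _ _ (same_mean_lin _ _ _ _ 2^-1 _ _ C1
    (same_mean_lin _ _ _ _ (2^-1 - 1) _ _ C2 C2))) => x.
  by rewrite vdotB vdotD cosB cosD; field.
- refine (same_ext _ _ _ (same_mean_lin _ _ _ _ 2^-1 _ _ S1
    (same_mean_lin _ _ _ _ (2^-1 - 1) _ _ S2 S2))) => x.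
  by rewrite vdotB vdotD sinB sinD; field.
Qed.

Lemma multiplier_sin a : multiplier (fun x => sin (vdot a x)).
Proof.
move=> F sF th; have [C1 S1] := sF (th + a); have [C2 S2] := sF (th - a); split.
- refine (same_ext _ _ _ (same_mean_lin _ _ _ _ 2^-1 _ _ S1
    (same_mean_lin _ _ _ _ (- 2^-1 - 1) _ _ S2 S2))) => x.
  by rewrite vdotB vdotD sinB sinD; field.
- refine (same_ext _ _ _ (same_mean_lin _ _ _ _ 2^-1 _ _ C2
    (same_mean_lin _ _ _ _ (- 2^-1 - 1) _ _ C1 C1))) => x.
  by rewrite vdotB vdotD cosB cosD; field.
Qed.

Lemma multiplier_sin_shift c b (j : 'I_k) :
  multiplier (fun x => sin (c * (x j ord0 - b))).
Proof.
have := multiplierD _ _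
  (multiplierM _ _ (multiplier_cst (cos (c * b))) (multiplier_sin (c *: delta_mx j ord0)))
  (multiplierM _ _ (multiplier_cst (- sin (c * b))) (multiplier_cos (c *: delta_mx j ord0))).
congr multiplier; apply/funext => x; rewrite vdot_delta mulrBr sinB /=; ring.
Qed.

(** Two nested bounded limits: i -> oo in the step polynomial yields the indicator of sin ((x_j - b)
    / (n + 1)) >= 0, then n -> oo yields that of x_j >= b. *)
Lemma multiplier_halfspace b (j : 'I_k) :
  multiplier (fun x => (b <= x j ord0)%R%:R).
Proof.
have b01 (b' : bool) : `|b'%:R : R| <= 1 by case: b'; rewrite ?normr1 ?normr0.
apply: (multiplier_lim (fun n x => (0 <= sin ((x j ord0 - b) / n.+1%:R))%R%:R)).
- move=> n.
  apply: (multiplier_lim (fun i x => step_poly i (sin (n.+1%:R^-1 * (x j ord0 - b))))).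
  + move=> i; apply: multiplierX.
    have mz := multiplierM _ _ (multiplier_cst 2^-1) (multiplierD _ _ (multiplier_cst 1)
       (multiplierM _ _ (multiplier_cst (-1)) (multiplier_sin_shift n.+1%:R^-1 b j))).
    have := multiplierD _ _ (multiplier_cst 1)
      (multiplierM _ _ (multiplier_cst (-1)) (multiplierX _ (i * i) mz)).
    congr multiplier; apply/funext => x /=.
    by rewrite mulN1r mulN1r [2^-1 * _]mulrC.
  + move=> i x; have /andP[p0 p1] : 0 <= step_poly i (sin (n.+1%:R^-1 * (x j ord0 - b))) <= 1.
      by apply: step_poly_itv; rewrite ler_norml sin_geN1 sin_le1.
    by rewrite ger0_norm.
  + move=> x; rewrite [_ / _]mulrC; apply: step_poly_cvg.
    by rewrite ler_norml sin_geN1 sin_le1.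
- by move=> n x; exact: b01.
- by move=> x; rewrite -subr_ge0; exact: sin_step_cvg.
Qed.

(** With lists of constraints, intersection is concatenation and the whole space is the empty
    list. *)
Definition orthant (s : seq ('I_k * R)) : set 'cV[R]_k :=
  [set x | all (fun c => c.2 <= x c.1 ord0) s].

Lemma multiplier_orthant s : multiplier (\1_(orthant s)).
Proof.
elim: s => [|c s IH].
  have := multiplier_cst 1; congr multiplier; apply/funext => x.
  by rewrite indicE mem_set.
have := multiplierM _ _ (multiplier_halfspace c.2 c.1) IH.
congr multiplier; apply/funext => x; rewrite !indicE -natrM mulnb; congr (nat_of_bool _)%:R.
apply/idP/idP => [/andP[cx /set_mem sx]|/set_mem/andP[cx sx]].
  by apply/mem_set/andP.
by rewrite cx; exact/mem_set.
Qed.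

End CharacteristicFunction.
Arguments orthant {R k} s _.

(** * Equality of laws from a pi-system and from characteristic functions *)

Section EqualLaws.
Context {R : realType} {d1 d2 : measure_display}.
Context {Om1 : measurableType d1} {Om2 : measurableType d2}.
Variables (P1 : probability Om1 R) (P2 : probability Om2 R).

(** Uniqueness of finite measures on a pi-system, applied to the image laws on [V] with the
    sigma-algebra generated by [G]; the constant sequence [setT] is the exhaustion. *)
Lemma eq_law_pi_system (V : pointedType) (G : set (set V))
    (X1 : Om1 -> V) (X2 : Om2 -> V) :
  setI_closed G -> G setT ->
  (forall A, G A -> measurable (X1 @^-1` A)) ->
  (forall A, G A -> measurable (X2 @^-1` A)) ->
  (forall A, G A -> P1 (X1 @^-1` A) = P2 (X2 @^-1` A)) ->
  forall A, <<s G >> A -> P1 (X1 @^-1` A) = P2 (X2 @^-1` A).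
Proof.
move=> GI GT mX1 mX2 eqG A GA.
have m1 : measurable_fun setT (X1 : Om1 -> g_sigma_algebraType G).
  have := @measurability _ _ Om1 (g_sigma_algebraType G) setT X1 G.
  by apply => // _ [B GB <-]; rewrite setTI; exact: mX1.
have m2 : measurable_fun setT (X2 : Om2 -> g_sigma_algebraType G).
  have := @measurability _ _ Om2 (g_sigma_algebraType G) setT X2 G.
  by apply => // _ [B GB <-]; rewrite setTI; exact: mX2.
pose Y1 : {mfun Om1 >-> g_sigma_algebraType G} := mfun_Sub (mem_set m1).
pose Y2 : {mfun Om2 >-> g_sigma_algebraType G} := mfun_Sub (mem_set m2).
apply: (@measure_unique _ R (g_sigma_algebraType G) G (fun=> setT) _ GI (fun=> GT) _
  (distribution P1 Y1) (distribution P2 Y2)) => //.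
- by rewrite bigcup_const//; exists 0%N.
- by move=> _; rewrite /= /distribution /pushforward preimage_setT probability_setT ltry.
Qed.

Lemma eq_law_charfun k (X1 : Om1 -> 'cV[R]_k) (X2 : Om2 -> 'cV[R]_k) :
  (forall B, mx_borel B -> measurable (X1 @^-1` B)) ->
  (forall B, mx_borel B -> measurable (X2 @^-1` B)) ->
  (forall th, \int[P1]_w (cos (vdot th (X1 w)))%:E
    = \int[P2]_w (cos (vdot th (X2 w)))%:E)%E ->
  (forall th, \int[P1]_w (sin (vdot th (X1 w)))%:E
    = \int[P2]_w (sin (vdot th (X2 w)))%:E)%E ->
  forall B, mx_borel B -> P1 (X1 @^-1` B) = P2 (X2 @^-1` B).
Proof.
move=> mX1 mX2 ecos esin B mB.
pose G : set (set 'cV[R]_k) := [set orthant s | s in setT].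
have orthant0 : orthant [::] = [set: 'cV[R]_k] by apply/seteqP; split.
have entryE j a : [set x : 'cV[R]_k | a <= x j ord0] = orthant [:: (j, a)].
  by apply/seteqP; split => x; rewrite /orthant /= andbT.
(* The identity is measurable from the orthant sigma-algebra to the Borel one because its entries
   are: their half-lines pull back to one-constraint orthants. *)
have mG : <<s G >> B.
  apply: (mx_measurable_fun _ (g_sigma_algebraType G) _ _ id) => // i j.
  rewrite (ord1 j); apply: (measurability _ (RGenCInfty.measurableE R)).
  move=> _ [_ [a ->] <-]; rewrite setTI; apply: sub_sigma_algebra.
  exists [:: (i, a)] => //; rewrite -entryE; apply/seteqP; split => x /=;
  by rewrite in_itv /= andbT.
have mO d (Om : measurableType d) (X : Om -> 'cV[R]_k) :
   (forall B, mx_borel B -> measurable (X @^-1` B)) ->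
   forall s, measurable (X @^-1` orthant s).
  move=> mX; elim => [|c s IH]; first by rewrite orthant0 preimage_setT.
  have -> : X @^-1` orthant (c :: s) =
      (fun w => X w c.1 ord0) @^-1` `[c.2, +oo[%classic `&` X @^-1` orthant s.
    by apply/seteqP; split => w /=; rewrite in_itv /= andbT => /andP.
  apply: measurableI => //; rewrite -[X in measurable X]setTI.
  by apply: measurable_fun_entry.
apply: (@eq_law_pi_system _ G) mG.
- move=> _ _ [s _ <-] [t _ <-]; exists (s ++ t) => //.
  by apply/seteqP; split => x; rewrite /orthant /= all_cat => /andP.
- by exists [::].
- by move=> _ [s _ <-]; exact: mO.
- by move=> _ [s _ <-]; exact: mO.
move=> _ [s _ <-].
(* Multiplying the constant 1 by the indicator and taking th = 0 leaves the probability of the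
   orthant. *)
have s1 := same_charfun1 P1 P2 _ X1 X2 mX1 mX2 ecos esin.
have := multiplier_orthant P1 P2 _ X1 X2 s _ s1.
move=> /same_charfun_same[_ _ _].
under eq_integral do rewrite /= mulr1.
under [in X in _ = X -> _]eq_integral do rewrite /= mulr1.
have H d (Om : measurableType d) (P : probability Om R) (X : Om -> 'cV[R]_k) :
   (forall B, mx_borel B -> measurable (X @^-1` B)) ->
   (\int[P]_w (\1_(orthant s) (X w))%:E = P (X @^-1` orthant s))%E.
  by move=> mX; rewrite -[X @^-1` _ in RHS]setIT -integral_indic//; last exact: mO.
by rewrite !H.
Qed.

End EqualLaws.

(** * Supports and joint law of the noise *)

Section EntrywiseMeasurable.
Context {R : realType} {d : measure_display} {Om : measurableType d}.

(** Equivalent to Borel measurability by [mx_measurable_fun] and [measurable_fun_entry], and easier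
    to propagate through matrix operations. *)
Definition mx_measurable {m k} (X : Om -> 'M[R]_(m, k)) : Prop :=
  forall i j, measurable_fun setT (fun w => X w i j).

Lemma mx_measurable_cst m k (M : 'M[R]_(m, k)) : mx_measurable (fun=> M).
Proof. by move=> i j; exact: measurable_cst. Qed.

Lemma mx_measurableD m k (X Y : Om -> 'M[R]_(m, k)) :
  mx_measurable X -> mx_measurable Y -> mx_measurable (fun w => X w + Y w).
Proof.
move=> mX mY i j; under eq_fun do rewrite mxE.
exact: measurable_funD (mX i j) (mY i j).
Qed.

Lemma mx_measurableM m k q (M : 'M[R]_(m, k)) (X : Om -> 'M[R]_(k, q)) :
  mx_measurable X -> mx_measurable (fun w => M *m X w).
Proof.
move=> mX i j; under eq_fun do rewrite mxE.
by apply: measurable_sum => h; apply: measurable_funM => //; exact: mX.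
Qed.

Lemma mx_measurable_sum m k n (X : 'I_n -> Om -> 'M[R]_(m, k)) :
  (forall t, mx_measurable (X t)) -> mx_measurable (fun w => \sum_(t < n) X t w).
Proof.
move=> mX i j; under eq_fun do rewrite summxE.
by apply: measurable_sum => h; exact: mX.
Qed.

Lemma mx_measurable_cols p k (Y : 'I_k -> Om -> 'cV[R]_p) :
  (forall j, mx_measurable (Y j)) ->
  mx_measurable (fun w => \matrix_(i < p, j < k) Y j w i ord0).
Proof. by move=> mY i j; under eq_fun do rewrite mxE; exact: mY. Qed.

Lemma mx_measurable_traj n m l (A : 'M[R]_n) (B : 'M[R]_(n, m)) (G : 'M[R]_(n, l))
    (w : nat -> Om -> 'cV[R]_l) x0 u t :
  (forall t, mx_measurable (w t)) -> mx_measurable (traj A B G w x0 u t).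
Proof.
move=> mw; apply: mx_measurableD; first exact: mx_measurable_cst.
apply: mx_measurable_sum => tau; apply: mx_measurableM.
apply: mx_measurableD; first exact: mx_measurable_cst.
exact: mx_measurableM.
Qed.

Lemma mx_measurable_outp n m l p (A : 'M[R]_n) (B : 'M[R]_(n, m)) (G : 'M[R]_(n, l))
    (C : 'M[R]_(p, n)) (w : nat -> Om -> 'cV[R]_l) (nu : nat -> Om -> 'cV[R]_p) x0 u t :
  (forall t, mx_measurable (w t)) -> (forall t, mx_measurable (nu t)) ->
  mx_measurable (outp A B G C w nu x0 u t).
Proof.
move=> mw mnu; apply: mx_measurableD => //; apply: mx_measurableM.
exact: mx_measurable_traj.
Qed.

End EntrywiseMeasurable.

(** * The support is Borel and has full measure *)

Section Support.
Context {R : realType} {d : measure_display} {Om : measurableType d}.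
Variables (P : probability Om R) (n : nat) (X : Om -> 'cV[R]_n).
Hypothesis mX : forall B, mx_borel B -> measurable (X @^-1` B).

(* Enumerates through [unpickle] the rational balls that X almost surely avoids. *)
Definition null_ratball (i : nat) : set 'cV[R]_n :=
  if unpickle i is Some c then
    if P (X @^-1` ratball c) == 0%E then ratball c else set0
  else set0.

Lemma null_ratballP i z : null_ratball i z ->
  exists c, [/\ P (X @^-1` ratball c) = 0%E, ratball c z & null_ratball i = ratball c].
Proof.
by rewrite /null_ratball; case: unpickle => // c; case: eqP => // P0 cz; exists c.
Qed.

Lemma borel_null_ratball i : mx_borel (null_ratball i).
Proof.
apply: sub_sigma_algebra; rewrite /null_ratball.
case: unpickle => [c|]; last exact: open0.
case: ifP => _; [exact: ball_open|exact: open0].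
Qed.

Lemma null_null_ratball i : P (X @^-1` null_ratball i) = 0%E.
Proof.
rewrite /null_ratball; case: unpickle => [c|]; last by rewrite preimage_set0 measure0.
by case: eqP => // _; rewrite preimage_set0 measure0.
Qed.

(** A point off the support has a null ball around it, which contains a null rational ball around
    that point. Conversely, a null rational ball contains a ball centred at each of its points. *)
Lemma supp_setC : ~` supp P X = \bigcup_i null_ratball i.
Proof.
have mball z e : measurable (X @^-1` ball z e).
  by apply: mX; apply: sub_sigma_algebra; exact: ball_open.
apply/seteqP; split => [z | z [i _ /null_ratballP[c [P0 cz _]]]] /=.
  move=> /existsNP[rho /not_implyP[rho0 /negP]]; rewrite -leNgt => P0.
  have [c cz cU] := ratball_basis _ _ (nbhsx_ballx z rho rho0).
  exists (pickle c) => //; rewrite /null_ratball pickleK; case: eqP => // -[].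
  apply/eqP; rewrite eq_le measure_ge0 andbT (le_trans _ P0)//.
  by apply: le_measure; rewrite ?inE; [exact: mball|exact: mball|move=> w /cU].
have /nbhs_ballP[e /= e0 ec] := open_nbhs_nbhs (conj (open_ratball c) cz).
move=> /(_ e e0); apply/negP; rewrite -leNgt -P0.
by apply: le_measure; rewrite ?inE; [exact: mball|exact: mball|move=> w /ec].
Qed.

Lemma borel_suppC : mx_borel (~` supp P X).
Proof.
rewrite supp_setC.
apply: (@bigcupT_measurable _ (g_sigma_algebraType (@open 'cV[R]_n))).
exact: borel_null_ratball.
Qed.

Lemma borel_supp : mx_borel (supp P X).
Proof.
rewrite -[supp P X]setCK.
exact: (@measurableC _ (g_sigma_algebraType (@open 'cV[R]_n))) borel_suppC.
Qed.

(** The complement of the support is a countable union of null balls, hence null. *)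
Lemma probability_supp B : mx_borel B ->
  P (X @^-1` B) = P (X @^-1` (B `&` supp P X)).
Proof.
move=> mB; rewrite preimage_setI.
have P0 : P (X @^-1` ~` supp P X) = 0%E.
  apply/eqP; rewrite eq_le measure_ge0 andbT supp_setC preimage_bigcup.
  apply: le_trans (measure_sigma_subadditive P _ _ (@subset_refl _ _)) _.
  - by move=> i; exact: mX _ (borel_null_ratball i).
  - by apply: bigcupT_measurable => i; exact: mX _ (borel_null_ratball i).
  by rewrite eseries0// => i _ _; exact: null_null_ratball.
have mS := mX _ borel_supp.
rewrite [LHS](measureDI P (mX _ mB) mS).
rewrite (@subset_measure0 _ _ _ P _ (X @^-1` ~` supp P X)) ?add0e//.
- by apply: measurableD => //; exact: mX.
- exact: mX _ borel_suppC.
Qed.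
End Support.

(** * The joint law of the noise on path space *)

Section NoiseLaw.
Context {R : realType} {l p : nat}.
Local Notation V := ((nat -> 'cV[R]_l) * (nat -> 'cV[R]_p))%type.

(** Exactly the events of the product rule in [noise_hyp], seen on the space of pairs of noise
    paths. *)
Definition cylinder : set (set V) := [set D | exists N Aw Bn,
  [/\ forall t, @mx_borel R l 1 (Aw t), forall t, @mx_borel R p 1 (Bn t) &
      D = \bigcap_(t in `I_N) [set v : V | Aw t (v.1 t) /\ Bn t (v.2 t)]]].

Lemma mx_borelT m k : mx_borel [set: 'M[R]_(m, k)].
Proof. exact: (@measurableT _ (g_sigma_algebraType (@open 'M[R]_(m, k)))). Qed.

Lemma mx_borelI m k (A B : set 'M[R]_(m, k)) :
  mx_borel A -> mx_borel B -> mx_borel (A `&` B).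
Proof. exact: (@measurableI _ (g_sigma_algebraType (@open 'M[R]_(m, k)))). Qed.

Lemma cylinderT : cylinder setT.
Proof.
exists 0%N, (fun=> setT), (fun=> setT); split => // [t|t|]; try exact: mx_borelT.
by apply/seteqP; split.
Qed.

Lemma cylinderI : setI_closed cylinder.
Proof.
move=> _ _ [N [Aw [Bn [mA mB ->]]]] [N' [Aw' [Bn' [mA' mB' ->]]]].
(* Padding with the full set beyond its own horizon lets each cylinder be described up to the common
   horizon [maxn N N']. *)
pose cut T N (S : nat -> set T) t := if (t < N)%N then S t else setT.
have mcut m k M (S : nat -> set 'M[R]_(m, k)) : (forall t, mx_borel (S t)) ->
    forall t, mx_borel (cut _ M S t).
  by move=> mS t; rewrite /cut; case: ifP => // _; exact: mx_borelT.
exists (maxn N N'), (fun t => cut _ N Aw t `&` cut _ N' Aw' t),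
  (fun t => cut _ N Bn t `&` cut _ N' Bn' t); split.
- by move=> t; apply: mx_borelI; exact: mcut.
- by move=> t; apply: mx_borelI; exact: mcut.
apply/seteqP; split => v.
  move=> [v1 v2] t _ /=; rewrite /cut; split; split; case: ifP => // tN.
  + by case: (v1 t tN).
  + by case: (v2 t tN).
  + by case: (v1 t tN).
  + by case: (v2 t tN).
move=> vc; split => t /= tN.
  have [|[a _] [b _]] := vc t; first by rewrite /= leq_max tN.
  by move: a b; rewrite /cut tN.
have [|[_ a] [_ b]] := vc t; first by rewrite /= leq_max tN orbT.
by move: a b; rewrite /cut tN.
Qed.

Lemma mx_measurable_coord1 t :
  mx_measurable ((fun v : V => v.1 t) : g_sigma_algebraType cylinder -> _).
Proof.
apply: measurable_fun_entry => B mB; apply: sub_sigma_algebra.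
(* Horizon t + 1, because [I_N] contains only the times below N. *)
exists t.+1, (fun s => if s == t then B else setT), (fun=> setT); split.
- by move=> s; case: ifP => // _; exact: mx_borelT.
- by move=> s; exact: mx_borelT.
apply/seteqP; split => v /=.
  by move=> Bv s _ /=; split => //; case: eqP => // ->.
by move=> /(_ t (ltnSn t))[] /=; rewrite eqxx.
Qed.

Lemma mx_measurable_coord2 t :
  mx_measurable ((fun v : V => v.2 t) : g_sigma_algebraType cylinder -> _).
Proof.
apply: measurable_fun_entry => B mB; apply: sub_sigma_algebra.
exists t.+1, (fun=> setT), (fun s => if s == t then B else setT); split.
- by move=> s; exact: mx_borelT.
- by move=> s; case: ifP => // _; exact: mx_borelT.
apply/seteqP; split => v /=.
  by move=> Bv s _ /=; split => //; case: eqP => // ->.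
by move=> /(_ t (ltnSn t))[] /= _; rewrite eqxx.
Qed.

(** By independence the probability of a cylinder is a product, whose factors agree since Gaussian
    laws with equal parameters have equal characteristic functions. Cylinders form a pi-system, so
    every measurable functional [Phi] of the noise paths has the same law on both spaces. *)
Lemma eq_law_noise d1 (Om1 : measurableType d1) (P1 : probability Om1 R)
    (w1 : nat -> Om1 -> 'cV[R]_l) (nu1 : nat -> Om1 -> 'cV[R]_p)
    d2 (Om2 : measurableType d2) (P2 : probability Om2 R)
    (w2 : nat -> Om2 -> 'cV[R]_l) (nu2 : nat -> Om2 -> 'cV[R]_p) mu Psi :
  noise_hyp P1 w1 nu1 mu Psi -> noise_hyp P2 w2 nu2 mu Psi ->
  forall a b (Phi : V -> 'M[R]_(a, b)),
    mx_measurable (Phi : g_sigma_algebraType cylinder -> _) ->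
  forall B, mx_borel B ->
    P1 ((fun om => Phi (w1^~ om, nu1^~ om)) @^-1` B) =
    P2 ((fun om => Phi (w2^~ om, nu2^~ om)) @^-1` B).
Proof.
move=> [gw1 [gn1 ind1]] [gw2 [gn2 ind2]] a b Phi mPhi B mB.
have mcyl d (Om : measurableType d) (w : nat -> Om -> 'cV[R]_l) (nu : nat -> Om -> 'cV[R]_p) :
    (forall t B, mx_borel B -> measurable (w t @^-1` B)) ->
    (forall t B, mx_borel B -> measurable (nu t @^-1` B)) ->
    forall D, cylinder D -> measurable ((fun om => (w^~ om, nu^~ om)) @^-1` D).
  move=> mw mnu _ [N [Aw [Bn [mA mB' ->]]]].
  rewrite preimage_bigcap; apply: fin_bigcap_measurable => // t _.
  by apply: (@measurableI _ _ (w t @^-1` Aw t) (nu t @^-1` Bn t)); [exact: mw|exact: mnu].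
apply: (@eq_law_pi_system R _ _ _ _ P1 P2 V cylinder
  (fun om => (w1^~ om, nu1^~ om)) (fun om => (w2^~ om, nu2^~ om)) _ _ _ _ _ (Phi @^-1` B)).
- exact: cylinderI.
- exact: cylinderT.
- by apply: mcyl => t; [case: (gw1 t)|case: (gn1 t)].
- by apply: mcyl => t; [case: (gw2 t)|case: (gn2 t)].
- move=> _ [N [Aw [Bn [mA mBn ->]]]]; rewrite !preimage_bigcap.
  transitivity (\prod_(t < N) (P1 (w1 t @^-1` Aw t) * P1 (nu1 t @^-1` Bn t)))%E.
    exact: ind1.
  transitivity (\prod_(t < N) (P2 (w2 t @^-1` Aw t) * P2 (nu2 t @^-1` Bn t)))%E; last first.
    by symmetry; exact: ind2.
  apply: eq_bigr => t _; congr (_ * _)%E.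
  + have [m1 c1] := gw1 t; have [m2 c2] := gw2 t.
    apply: eq_law_charfun => // th; have [C1 S1] := c1 th; have [C2 S2] := c2 th.
      by rewrite C1 C2.
    by rewrite S1 S2.
  + have [m1 c1] := gn1 t; have [m2 c2] := gn2 t.
    apply: eq_law_charfun => // th; have [C1 S1] := c1 th; have [C2 S2] := c2 th.
      by rewrite C1 C2.
    by rewrite S1 S2.
- exact: (mx_measurable_fun _ (g_sigma_algebraType cylinder)).
Qed.

End NoiseLaw.

(** * Linear systems *)

Section ReachableSpace.
Context {R : realType}.

(** Cayley-Hamilton: the remainder of X^k modulo the characteristic polynomial takes the same value
    at A and has degree below n. *)
Lemma expmx_lin_comb n (A : 'M[R]_n) k :
  exists c : 'I_n -> R, A ^+ k = \sum_(i < n) c i *: A ^+ i.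
Proof.
case: n A => [|n] A; first by exists (fun=> 0); rewrite big_ord0 [LHS]flatmx0.
pose q := ('X^k %% char_poly A)%R.
exists (fun i => q`_i).
have sq : (size q <= n.+1)%N.
  by rewrite -ltnS -(size_char_poly A) ltn_modp -size_poly_eq0 size_char_poly.
transitivity (horner_mx A 'X^k); first by rewrite rmorphXn /= horner_mx_X.
rewrite (divp_eq 'X^k (char_poly A)) rmorphD rmorphM /= Cayley_Hamilton mulr0 add0r -/q.
have -> : q = \poly_(i < n.+1) q`_i.
  apply/polyP => i; rewrite coef_poly; case: ltnP => // ni.
  by rewrite nth_default// (leq_trans sq).
rewrite poly_def linear_sum /=; apply: eq_bigr => i _.
by rewrite horner_mxZ rmorphXn /= horner_mx_X -poly_def coef_poly ltn_ord.
Qed.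

(** Here [k] may exceed n - 1, the largest power in [reach_im]; the coefficients of the reduction
    are absorbed into the vectors. *)
Lemma reach_im_expmx n l (A : 'M[R]_n) (G : 'M[R]_(n, l)) k v :
  reach_im A G (A ^+ k *m G *m v).
Proof.
have [c ->] := expmx_lin_comb _ A k; exists (fun i => c i *: v).
rewrite !mulmx_suml; apply: eq_bigr => i _.
by rewrite -!scalemxAl scalemxAr.
Qed.

Lemma reach_im_sum n l (A : 'M[R]_n) (G : 'M[R]_(n, l)) (I : finType) (f : I -> 'cV[R]_n) :
  (forall i, reach_im A G (f i)) -> reach_im A G (\sum_i f i).
Proof.
move=> /choice[v fv]; exists (fun k => \sum_i v i k).
under [RHS]eq_bigr do rewrite mulmx_sumr.
by rewrite exchange_big; apply: eq_bigr => i _; exact: fv.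
Qed.

End ReachableSpace.

Section SupportAffine.
Context {R : realType} {d : measure_display} {Om : measurableType d}.

Lemma continuous_mulmx_entry n k (L : 'M[R]_(k, n)) i :
  continuous (fun x : 'cV[R]_n => (L *m x) i ord0).
Proof.
move=> x; under eq_fun do rewrite mxE; rewrite /continuous_at.
apply: (@cvg_big R^o _ _ _ _ _ _ (nbhs x) _
  (fun j (y : 'cV[R]_n) => L i j * y j ord0)) => [|j _]; first exact: add_continuous.
by apply: cvgMr; exact: coord_continuous.
Qed.

(** Off the affine subspace some entry of L z differs from that of b. This is an open condition, so
    a whole ball around z is never visited. *)
Lemma supp_sub_affine (P : probability Om R) n k (X : Om -> 'cV[R]_n)
    (L : 'M[R]_(k, n)) (b : 'cV[R]_k) :
  (forall om, L *m X om = b) -> supp P X `<=` [set x | L *m x = b].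
Proof.
move=> LX z zs; apply: contrapT => /eqP Lz.
have [i Lzi] : exists i, (L *m z) i ord0 != b i ord0.
  apply/existsP; apply: contraNT Lz => /existsPn H; apply/eqP/matrixP => i j.
  by rewrite (ord1 j); have /negPn/eqP := H i.
have : nbhs z [set x | (L *m x) i ord0 != b i ord0].
  have oU := @open_neq R (b i ord0).
  exact: (@continuous_mulmx_entry n k L i z _ (open_nbhs_nbhs (conj oU Lzi))).
move=> /nbhs_ballP[e /= e0 ez]; have := zs e e0.
rewrite (_ : _ @^-1` _ = set0) ?measure0 ?ltxx//.
by apply/seteqP; split => // om /ez /=; rewrite LX eqxx.
Qed.

End SupportAffine.

(** * Trajectories under an intertwining map, and their noise-free part *)

Section Quotient.
Context {R : realType} {n q m l p : nat}.
Variables (A : 'M[R]_n) (A1 : 'M[R]_q) (B : 'M[R]_(n, m)) (G : 'M[R]_(n, l)).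
Variable Q : 'M[R]_(q, n).
Hypothesis QA : Q *m A = A1 *m Q.
Context {d : measure_display} {Om : measurableType d}.
Variable w : nat -> Om -> 'cV[R]_l.

Lemma mulmx_expmx_intertwine k : Q *m A ^+ k = A1 ^+ k *m Q.
Proof.
elim: k => [|k IH]; first by rewrite !expr0 mulmx1 mul1mx.
by rewrite !exprS -!mulmxE mulmxA QA -mulmxA IH mulmxA.
Qed.

Lemma mulmx_traj x0 u t om :
  Q *m traj A B G w x0 u t om = traj A1 (Q *m B) (Q *m G) w (Q *m x0) u t om.
Proof.
rewrite /traj mulmxDr !mulmxA mulmx_expmx_intertwine; congr (_ + _).
rewrite mulmx_sumr; apply: eq_bigr => tau _.
by rewrite mulmxA mulmx_expmx_intertwine -!mulmxA mulmxDr !mulmxA.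
Qed.

End Quotient.

Section NoiseFreePart.
Context {R : realType} {n m l : nat}.
Variables (A : 'M[R]_n) (B : 'M[R]_(n, m)) (G : 'M[R]_(n, l)).
Context {d : measure_display} {Om : measurableType d}.
Variable w : nat -> Om -> 'cV[R]_l.

Definition drift (x0 : 'cV[R]_n) (u : nat -> 'cV[R]_m) (t : nat) : 'cV[R]_n :=
  A ^+ t *m x0 + \sum_(tau < t) A ^+ (t - tau).-1 *m (B *m u tau).

(** The difference is a sum of terms A^k G w(tau), reachable even for k >= n. *)
Lemma reach_im_traj x0 u t om : reach_im A G (traj A B G w x0 u t om - drift x0 u t).
Proof.
rewrite /traj /drift opprD addrACA subrr add0r -sumrB.
apply: reach_im_sum => tau; rewrite mulmxDr addrC addKr mulmxA.
exact: reach_im_expmx.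
Qed.

End NoiseFreePart.

Lemma mulmx_cV_eq0 (R : realType) (m n : nat) (M : 'M[R]_(m, n)) :
  (forall v : 'cV[R]_n, M *m v = 0) -> M = 0.
Proof.
move=> M0; apply/matrixP => i j.
by have /matrixP/(_ i ord0) := M0 (delta_mx j ord0); rewrite -colE !mxE.
Qed.

(* The state dimension n of Sigma is written nb + n2 with nb = rank R. *)
Theorem theorem4 (R : realType) (nb n2 m l p r : nat)
  (A : 'M[R]_(nb + n2)) (B : 'M[R]_(nb + n2, m)) (G : 'M[R]_(nb + n2, l))
  (C : 'M[R]_(p, nb + n2)) (mu : 'cV[R]_l) (Psi : 'M[R]_p)
  (Rm : 'M[R]_(r, nb + n2))
  (T1 : 'M[R]_(nb + n2, nb)) (T2 : 'M[R]_(nb + n2, n2)) :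
  \rank Rm = nb ->
  (forall x, mxker Rm x -> mxker Rm (A *m x)) ->
  mxker Rm `<=` mxker C ->
  mxker Rm `&` reach_im A G = [set 0] ->
  row_mx T1 T2 \in unitmx ->
  mximg T2 = mxker Rm ->
  reach_im A G `<=` mximg T1 ->
  forall (d1 : measure_display) (Om1 : measurableType d1) (P1 : probability Om1 R)
         (w1 : nat -> Om1 -> 'cV[R]_l) (nu1 : nat -> Om1 -> 'cV[R]_p),
  noise_hyp P1 w1 nu1 mu Psi ->
  forall (d2 : measure_display) (Om2 : measurableType d2) (P2 : probability Om2 R)
         (w2 : nat -> Om2 -> 'cV[R]_l) (nu2 : nat -> Om2 -> 'cV[R]_p),
  noise_hyp P2 w2 nu2 mu Psi ->
  let Ti := invmx (row_mx T1 T2) in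
  bisimilar (ulsubmx (Ti *m A *m row_mx T1 T2)) (usubmx (Ti *m B))
            (usubmx (Ti *m G)) (C *m T1) P1 w1 nu1
            A B G C P2 w2 nu2.
Proof.
move=> _ kerA kerC _ Tu imT2 reachT1 d1 Om1 P1 w1 nu1 noise1 d2 Om2 P2 w2 nu2 noise2 Ti.
set Q := usubmx Ti; set L := dsubmx Ti.
have TiT : Ti *m row_mx T1 T2 = 1%:M by exact: mulVmx.
(* [Q] and [L] give the coordinates along [T1] and [T2]; these identities are blocks of T^-1 T =
   1. *)
have [QT1 QT2 LT1] : [/\ Q *m T1 = 1%:M, Q *m T2 = 0 & L *m T1 = 0].
  move: TiT; rewrite -[Ti]vsubmxK mul_col_row scalar_mx_block.
  by move=> /eq_block_mx[].
have T1QT2L : T1 *m Q + T2 *m L = 1%:M.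
  by rewrite -mul_row_col vsubmxK; exact: mulmxV.
rewrite -!mul_usub_mx -/Q.
have -> : ulsubmx (Ti *m A *m row_mx T1 T2) = Q *m A *m T1.
  by rewrite /ulsubmx -!mul_usub_mx -/Q mul_mx_row row_mxKl.
set A1 := Q *m A *m T1.
(* Insert 1 = T1 Q + T2 L on the right: Q A T2 vanishes because A preserves ker R = im T2, on which
   Q is zero. *)
have QA : Q *m A = A1 *m Q.
  have QAT2 : Q *m A *m T2 = 0.
    apply: mulmx_cV_eq0 => v; rewrite -!mulmxA.
    have : mxker Rm (A *m (T2 *m v)) by apply: kerA; rewrite -imT2; exists v.
    by rewrite -imT2 => -[v' ->]; rewrite mulmxA QT2 mul0mx.
  by rewrite -[LHS]mulmx1 -T1QT2L mulmxDr !mulmxA QAT2 mul0mx addr0.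
have CE : C = C *m T1 *m Q.
  have CT2 : C *m T2 = 0.
    apply: mulmx_cV_eq0 => v; rewrite -mulmxA.
    by apply: kerC; rewrite -imT2; exists v.
  by rewrite -[LHS]mulmx1 -T1QT2L mulmxDr !mulmxA CT2 mul0mx addr0.
pose S := [set x : 'cV[R]_nb * 'cV[R]_(nb + n2) | x.1 = Q *m x.2].
exists S; split; last first.
  split; apply/seteqP; split => // x _; first by exists (Q *m x).
  (* [T1] is a right inverse of [Q], so each quotient state has a partner. *)
  by exists (T1 *m x) => //; rewrite /S /= mulmxA QT1 mul1mx.
split.
  split; first by rewrite /S /= mulmx0.
  by move=> a x y; rewrite /S /= => -> ->; rewrite mulmxDr scalemxAr.
move=> x10 x0; rewrite /S /= => -> u t.
have [mw1 mnu1] : (forall t, mx_measurable (w1 t)) /\ (forall t, mx_measurable (nu1 t)).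
  case: noise1 => gw [gn _]; split => s; apply: measurable_fun_entry.
    by case: (gw s).
  by case: (gn s).
have [mw2 mnu2] : (forall t, mx_measurable (w2 t)) /\ (forall t, mx_measurable (nu2 t)).
  case: noise2 => gw [gn _]; split => s; apply: measurable_fun_entry.
    by case: (gw s).
  by case: (gn s).
pose V := g_sigma_algebraType (@cylinder R l p).
pose X1 := traj A1 (Q *m B) (Q *m G) w1 (Q *m x0) u t.
pose X2 := traj A B G w2 x0 u t.
have mX1 E : mx_borel E -> measurable (X1 @^-1` E).
  by apply: mx_measurable_fun; exact: mx_measurable_traj.
have mX2 E : mx_borel E -> measurable (X2 @^-1` E).
  by apply: mx_measurable_fun; exact: mx_measurable_traj.
(* The change of probability space: Q X2 is the quotient trajectory driven by the second noise,
   hence the same functional of the noise paths as X1. *)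
have eq_traj E : mx_borel E -> P1 (X1 @^-1` E) = P2 ((fun om => Q *m X2 om) @^-1` E).
  move=> mE; have -> : (fun om => Q *m X2 om) = traj A1 (Q *m B) (Q *m G) w2 (Q *m x0) u t.
    by apply/funext => om; exact: mulmx_traj.
  have mPhi : mx_measurable (@traj R _ V _ _ _ A1 (Q *m B) (Q *m G)
      (fun s v => v.1 s) (Q *m x0) u t).
    by apply: mx_measurable_traj => s; exact: mx_measurable_coord1.
  exact: (eq_law_noise _ _ _ _ _ _ _ _ _ _ _ _ noise1 noise2 _ _ _ mPhi _ mE).
split; [|split].
(* Clause (i): the image under [S] is a preimage under [Q], so [eq_traj] applies directly once E is
   cut down to the support. *)
- move=> E mE _; rewrite -/X1 -/X2 (probability_supp P1 _ X1 mX1 _ mE).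
  rewrite eq_traj; last by apply: mx_borelI => //; exact: borel_supp.
  congr (P2 _); apply/seteqP; split => om.
    by exists (Q *m X2 om).
  by move=> [x Ex /= <-].
- move=> E mE _; rewrite -/X1 -/X2 (probability_supp P2 _ X2 mX2 _ mE).
  set ES := E `&` supp P2 X2.
  have mES : mx_borel ES by apply: mx_borelI => //; exact: borel_supp.
  pose c := drift A B x0 u t.
  (* Noise moves the state only within im(Reach), contained in im T1, which L annihilates. *)
  have LX2 om : L *m X2 om = L *m c.
    apply/eqP; rewrite -subr_eq0 -mulmxBr; apply/eqP.
    have [v ->] := reachT1 _ (reach_im_traj A B G w2 x0 u t om).
    by rewrite mulmxA LT1 mul0mx.
  (* On the slice L x = L c, the state is an affine function of Q x. *)
  have lift x : L *m x = L *m c -> x = c + T1 *m (Q *m x - Q *m c).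
    move=> Lx; rewrite -mulmxBr mulmxA.
    have Lxc : L *m (x - c) = 0 by rewrite mulmxBr Lx subrr.
    have := congr1 (mulmxr (x - c)) T1QT2L.
    rewrite /= mul1mx mulmxDl -[T2 *m L *m _]mulmxA Lxc mulmx0 addr0 => ->.
    by rewrite addrC subrK.
  have ESL x : ES x -> L *m x = L *m c.
    by move=> [_]; exact: supp_sub_affine.
  (* The left side is the image of [ES] under [Q]; written as a preimage under the affine inverse,
     it is visibly Borel. *)
  have preE : rel_pre S ES = (fun x1 => c + T1 *m (x1 - Q *m c)) @^-1` ES.
    apply/seteqP; split => [x1 [x ESx]|x1 ESx]; rewrite /S /=.
      by move=> ->; rewrite -lift//; exact: ESL.
    exists (c + T1 *m (x1 - Q *m c)) => //=.
    by rewrite mulmxDr [in RHS]mulmxA QT1 mul1mx addrC subrK.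
  rewrite eq_traj; last first.
    rewrite preE.
    apply: (mx_measurable_fun _ (g_sigma_algebraType (@open 'cV[R]_nb))) mES.
    apply: mx_measurableD; first exact: mx_measurable_cst.
    apply: mx_measurableM; apply: mx_measurableD; last exact: mx_measurable_cst.
    by move=> i j; exact: measurable_entry.
  congr (P2 _); rewrite preE; apply/seteqP; split => om /=.
    by rewrite -lift.
  by rewrite -lift.
- move=> k ts E mE.
  (* Clause (iii): C = C T1 Q makes the two outputs equal pointwise under the second noise, so only
     the change of probability space remains. *)
  have -> : outp A B G C w2 nu2 x0 u =
            outp A1 (Q *m B) (Q *m G) (C *m T1) w2 nu2 (Q *m x0) u.
    apply/funext => s; apply/funext => om.
    by rewrite /outp {1}CE -mulmxA (mulmx_traj _ _ _ _ _ QA).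
  have mPhi : mx_measurable ((fun v => \matrix_(i < p, j < k)
      @outp R _ V _ _ _ _ A1 (Q *m B) (Q *m G) (C *m T1) (fun s v => v.1 s)
        (fun s v => v.2 s) (Q *m x0) u (ts j) v i ord0) : V -> _).
    apply: mx_measurable_cols => j; apply: mx_measurable_outp => s.
      exact: mx_measurable_coord1.
    exact: mx_measurable_coord2.
  exact: (eq_law_noise _ _ _ _ _ _ _ _ _ _ _ _ noise1 noise2 _ _ _ mPhi _ mE).
Qed.
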